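(* Let $\mathbf E=(E,+,{}',0,1)$ be an effect algebra and $a,b,c\in E$. Then: (i) $(a\rightarrow 0)\rightarrow 0=\{a\}$; (ii) $a\rightarrow(b\rightarrow c)=a\rightarrow b'$; (iii) $a\rightarrow U(b)=a\rightarrow b$; (iv) $U(a)\rightarrow b=U(a)\rightarrow U(b)=U(a',b')\rightarrow a'=L(a')+L(a,b)$; (v) $a\rightarrow L(a,b)=\{a'\}$; (vi) $a\rightarrow U(a,b)=a'+L(a)$; (vii) $U(a\rightarrow U(a,b))=\{1\}$.
   Context: An effect algebra is a partial algebra $(E,+,{}',0,1)$ of type $(2,1,0,0)$ where $+$ is a partial binary operation such that for all $x,y,z\in E$: (E1) $x+y$ is defined iff $y+x$ is defined, and then $x+y=y+x$; (E2) $(x+y)+z$ is defined iff $x+(y+z)$ is defined, and then they are equal; (E3) $x'$ is the unique $u\in E$ with $x+u=1$; (E4) if $1+x$ is defined then $x=0$. The induced order is $x\leq y$ iff $x+z=y$ for some $z\in E$; $x+y$ is defined iff $x\leq y'$. For $A\subseteq E$, $L(A)=\{x\mid x\leq y\ \forall y\in A\}$, $U(A)=\{x\mid y\leq x\ \forall y\in A\}$; $L(a,b)=L(\{a,b\})$, $L(A,a)=L(A\cup\{a\})$, $L(A,B)=L(A\cup B)$, and analogously for $U$. For subsets $A,B$: $A\leq B$ means $u\leq v$ for all $u\in A,v\in B$; $A'=\{u'\mid u\in A\}$; if $A\leq x'$ then $x+A=\{x+u\mid u\in A\}$; if $A\leq B'$ then $A+B=\{u+v\mid u\in A,v\in B\}$.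 Implication: for elements $x,y$ and subsets $A,B$: $x\rightarrow y:=x'+L(x,y)$, $x\rightarrow B:=x'+L(x,B)$, $A\rightarrow y:=A'+L(A,y)$, $A\rightarrow B:=A'+L(A,B)$. A singleton set $\{x\}$ in the left argument is treated by the formula $A\rightarrow y$ with $A=\{x\}$. *)

(* Defs.v *)
From HB Require Import structures.
From mathcomp Require Import all_boot.
From mathcomp Require Import classical_sets.

Set Implicit Arguments.
Unset Strict Implicit.
Unset Printing Implicit Defensive.

Local Open Scope classical_set_scope.

(* The partial sum is option-valued: [eadd x y = None] means "x + y is
   undefined".  Equality of options in [eaddC] and [eaddA] expresses both that
   one side is defined iff the other is, and that they are then equal.
   The case 0 = 1 is not excluded. *)
HB.mixin Record isEffectAlgebra E := {
  eadd : E -> E -> option E;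
  ecompl : E -> E;
  ezero : E;
  eone : E;
  eaddC : forall x y, eadd x y = eadd y x;
  eaddA : forall x y z,
    obind (fun s => eadd s z) (eadd x y) = obind (eadd x) (eadd y z);
  ecomplP : forall x u, eadd x u = Some eone <-> u = ecompl x;
  eadd1_def : forall x, isSome (eadd eone x) -> x = ezero
}.

#[short(type="effectAlgebraType")]
HB.structure Definition EffectAlgebra := {E of isEffectAlgebra E}.

Arguments ezero {_}.
Arguments eone {_}.

Section EffectAlgebraTheory.
Variable E : effectAlgebraType.
Implicit Types (x y : E) (A B : set E).

Definition ele x y : Prop := exists z, eadd x z = Some y.

Definition sle A B : Prop := forall u v, A u -> B v -> ele u v.

Definition scompl A : set E := [set ecompl u | u in A].

Definition lower A : set E := [set x | forall y, A y -> ele x y].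

Definition upper A : set E := [set x | forall y, A y -> ele y x].

(* The sums of an element with a set and of two sets are partial operations:
   each takes a proof of its definedness condition, on which the value does
   not depend. *)
Definition eset_add x A (_ : sle A [set ecompl x]) : set E :=
  [set z | exists2 u, A u & eadd x u = Some z].

Definition sset_add A B (_ : sle A (scompl B)) : set E :=
  [set z | exists2 u, A u & exists2 v, B v & eadd u v = Some z].

Lemma ecomplK x : ecompl (ecompl x) = x.
Proof. by apply/esym/ecomplP; rewrite eaddC; apply/ecomplP. Qed.

Lemma ele_compl x y : ele x y -> ele (ecompl y) (ecompl x).
Proof.
move=> [z xz]; have := eaddA x z (ecompl y); rewrite xz /=.
have -> : eadd y (ecompl y) = Some eone by apply/ecomplP.
case zy: (eadd z (ecompl y)) => [w|//] /= /esym/ecomplP wx.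
by exists z; rewrite eaddC zy wx.
Qed.

Lemma eimp_orth x B : sle (lower (x |` B)) [set ecompl (ecompl x)].
Proof. by move=> u _ Lu ->; rewrite ecomplK; apply: Lu; left. Qed.

Lemma simp_orth A B : sle (scompl A) (scompl (lower (A `|` B))).
Proof. by move=> _ _ [u Au <-] [v Lv <-]; apply/ele_compl/Lv; left. Qed.

(* The implication A -> B = A' + L(A, B); the letters tell whether each
   argument is an element (e) or a set (s).  The definedness condition of the
   sum on the right always holds, so implication is total. *)
Definition imp_ee x y : set E := eset_add (@eimp_orth x [set y]).

Definition imp_es x B : set E := eset_add (@eimp_orth x B).

Definition imp_se A y : set E := sset_add (@simp_orth A [set y]).

Definition imp_ss A B : set E := sset_add (@simp_orth A B).

End EffectAlgebraTheory.

Arguments eset_add {E} x A _.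
Arguments sset_add {E} A B _.

(* Main.v *)
Require Import Defs.
From mathcomp Require Import all_boot.
From mathcomp Require Import classical_sets.
Local Open Scope classical_set_scope.

(** Every clause is an identity between the summands of two partial sums.  The
    complement turns [upper] into [lower], and a lower cone depends only on the
    least element of the set when there is one: [x] for [upper [set x]], [x']
    for [x -> y] (which contains x' + 0), and 0 for any set containing 0. *)

Section EffectAlgebraLemmas.
Local Set Implicit Arguments.
Local Unset Strict Implicit.
Variable E : effectAlgebraType.
Implicit Types (x y z : E) (A B : set E).

Lemma eadd_compl x : eadd x (ecompl x) = Some eone.
Proof. exact/ecomplP. Qed.

Lemma ecompl1 : ecompl eone = ezero :> E.
Proof. by apply: eadd1_def; rewrite eadd_compl. Qed.

(** Since 0 = 1', associativity on x', x, 0 evaluates to 1 + 1' = 1. So x + 0 is defined, and its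
    sum with x' is 1, which makes it x''. *)
Lemma eaddx0 x : eadd x ezero = Some x.
Proof.
have := eaddA (ecompl x) x ezero.
rewrite [eadd (ecompl x) x]eaddC eadd_compl /= -ecompl1 eadd_compl.
case: (eadd x _) => [w|//] /= /esym/ecomplP ->.
by rewrite ecomplK.
Qed.

Lemma ele_refl x : ele x x.
Proof. by exists ezero; exact: eaddx0. Qed.

Lemma ele_trans y x z : ele x y -> ele y z -> ele x z.
Proof.
move=> [u xu] [v yv]; have := eaddA x u v; rewrite xu /= yv.
by case: (eadd u v) => [w|//] /= /esym xw; exists w.
Qed.

Lemma ele0x x : ele ezero x.
Proof. by exists x; rewrite eaddC eaddx0. Qed.

Lemma elex1 x : ele x eone.
Proof. by exists (ecompl x); exact: eadd_compl. Qed.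

Lemma ele1x x : ele eone x -> x = eone.
Proof.
move=> [z z1]; have z0 : z = ezero by apply: eadd1_def; rewrite z1.
by move: z1; rewrite z0 eaddx0 => -[].
Qed.

Lemma elex0 x : ele x ezero -> x = ezero.
Proof.
move=> /ele_compl; rewrite -ecompl1 ecomplK => /ele1x x1.
by rewrite -[LHS]ecomplK x1.
Qed.

(** Reduces an equation of sums to one of the summands, whatever the orthogonality proofs: both
    sides are convertible once the sets agree. *)
Lemma eset_add_eq x A B hA hB : A = B -> eset_add x A hA = eset_add x B hB.
Proof. by move=> AB; subst B. Qed.

Lemma sset_add_eq A B C D hAB hCD : A = C -> B = D ->
  sset_add A B hAB = sset_add C D hCD :> set E.
Proof. by move=> AC BD; subst C D. Qed.

Lemma sset_addC A B hAB hBA : sset_add A B hAB = sset_add B A hBA :> set E.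
Proof.
by apply/seteqP; split=> z [u Au [v Bv uv]]; exists v => //; exists u => //;
  rewrite eaddC.
Qed.

Lemma eset_add0 x h : eset_add x [set ezero] h = [set x].
Proof.
apply/seteqP; split=> [z [_ ->]|_ ->]; first by rewrite eaddx0 => -[<-].
by exists ezero => //; exact: eaddx0.
Qed.

Lemma sset_add1 x A h h' : sset_add [set x] A h = eset_add x A h'.
Proof.
apply/seteqP; split=> z; first by move=> [_ -> [v Av xv]]; exists v.
by move=> [v Av xv]; exists x => //; exists v.
Qed.

Lemma scompl1 x : scompl [set x] = [set ecompl x].
Proof. exact: image_set1. Qed.

Lemma scompl2 x y : scompl [set x; y] = [set ecompl x; ecompl y].
Proof. by rewrite /scompl image_setU !image_set1. Qed.

(** The complement is an order-reversing involution, so it exchanges upper and lower bounds. *)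
Lemma scompl_upper A : scompl (upper A) = lower (scompl A).
Proof.
apply/seteqP; split=> [_ [u Uu <-] _ [v Av <-]|x Lx].
  exact/ele_compl/Uu.
exists (ecompl x); last exact: ecomplK.
by move=> y Ay; rewrite -(ecomplK y); apply/ele_compl/Lx; exists y.
Qed.

Lemma lowerU A B : lower (A `|` B) = lower A `&` lower B.
Proof.
apply/seteqP; split=> [x Lx|x [LA LB] y [|]]; [|exact: LA|exact: LB].
by split=> y ?; apply: Lx; [left|right].
Qed.

Lemma lower1P x y : lower [set y] x <-> ele x y.
Proof. by split=> [|xy _ ->//]; apply. Qed.

Lemma lower_least A x : A x -> (forall y, A y -> ele x y) ->
  lower A = lower [set x].
Proof.
move=> Ax minx; apply/seteqP; split=> z Lz; first by apply/lower1P/Lz.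
by move=> y Ay; apply: (@ele_trans x); [exact/lower1P|exact: minx].
Qed.

Lemma lower0 : lower [set ezero] = [set ezero] :> set E.
Proof.
apply/seteqP; split=> [x /lower1P/elex0 //|_ ->].
exact/lower1P/ele_refl.
Qed.

Lemma lower_with0 A : A ezero -> lower A = [set ezero].
Proof. by move=> A0; rewrite -lower0; apply: lower_least => // y _; exact: ele0x. Qed.

Lemma lower_upper1 x : lower (upper [set x]) = lower [set x].
Proof. by apply: lower_least => [_ ->|y]; [exact: ele_refl|apply]. Qed.

(** Upper bounds of [A] lie above its member [x], so [x] is least in the union. *)
Lemma lower_U_upper x A : A x -> lower ([set x] `|` upper A) = lower [set x].
Proof.
move=> Ax; apply: lower_least => [|y [->|Uy]]; [by left|exact: ele_refl|exact: Uy].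
Qed.

Lemma lower_imp x y : lower (imp_ee x y) = lower [set ecompl x].
Proof.
apply: lower_least => [|z [u _ xu]]; last by exists u.
exists ezero; last exact: eaddx0.
by move=> z _; exact: ele0x.
Qed.

Lemma lower_orth x A : A x -> sle (lower [set ecompl x]) (scompl (lower A)).
Proof.
move=> Ax u _ /lower1P ux [v Lv <-].
by apply: (ele_trans ux); apply/ele_compl/Lv.
Qed.

End EffectAlgebraLemmas.

Theorem theorem5 (E : effectAlgebraType) (a b c : E) :
  (* (i) *)
  imp_se (imp_ee a ezero) ezero = [set a] /\
  (* (ii) *)
  imp_es a (imp_ee b c) = imp_ee a (ecompl b) /\
  (* (iii) *)
  imp_es a (upper [set b]) = imp_ee a b /\
  (* (iv) *)
  (exists h : sle (lower [set ecompl a]) (scompl (lower [set a; b])),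
    imp_se (upper [set a]) b = imp_ss (upper [set a]) (upper [set b]) /\
    imp_ss (upper [set a]) (upper [set b])
      = imp_se (upper [set ecompl a; ecompl b]) (ecompl a) /\
    imp_se (upper [set ecompl a; ecompl b]) (ecompl a)
      = sset_add (lower [set ecompl a]) (lower [set a; b]) h) /\
  (* (v) *)
  imp_es a (lower [set a; b]) = [set ecompl a] /\
  (* (vi) *)
  (exists h : sle (lower [set a]) [set ecompl (ecompl a)],
    imp_es a (upper [set a; b]) = eset_add (ecompl a) (lower [set a]) h) /\
  (* (vii) *)
  upper (imp_es a (upper [set a; b])) = [set eone].
Proof.
have Lab_upper : lower ([set a] `|` upper [set a; b]) = lower [set a].
  by apply: lower_U_upper; left.
have hvi : sle (lower [set a]) [set ecompl (ecompl a)].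
  by move=> u _ /lower1P ua ->; rewrite ecomplK.
have evi : imp_es a (upper [set a; b]) = eset_add (ecompl a) (lower [set a]) hvi.
  exact: eset_add_eq.
split.
  have -> : imp_ee a ezero = [set ecompl a].
    (* The singleton is read as the sum a' + {0}, so that only L(a, 0) = {0} remains. *)
    rewrite -(@eset_add0 _ (ecompl a)) => [u _ -> ->|h]; first exact: ele0x.
    by apply: eset_add_eq; apply: lower_with0; right.
  have h0 : sle [set ezero] [set ecompl a] by move=> _ _ -> ->; exact: ele0x.
  (* Likewise {a} becomes {a} + {0}, which is defined as a <= 0' = 1; its first summand is the
     complement of {a'}. *)
  rewrite -(eset_add0 h0) -(@sset_add1 _ a _) => [u _ -> [_ -> <-]|h].
    by rewrite -ecompl1 ecomplK; exact: elex1.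
  apply: sset_add_eq; first by rewrite scompl1 ecomplK.
  by apply: lower_with0; right.
(* L(a, b -> c) is the intersection of L(a) with L(b -> c) = L(b'). *)
split; first by apply: eset_add_eq; rewrite !lowerU lower_imp.
split; first by apply: eset_add_eq; rewrite !lowerU lower_upper1.
split.
  have hiv : sle (lower [set ecompl a]) (scompl (lower [set a; b])).
    by apply: lower_orth; left.
  have hvi' : sle (lower [set a; b]) (scompl (lower [set ecompl a])).
    (* Orthogonality is symmetric: u <= v' follows from v <= u'. *)
    move=> u _ Lu [v Lv <-]; rewrite -(ecomplK u); apply/ele_compl.
    by have := hiv v (ecompl u) Lv; apply; exists u.
  have e1 : imp_se (upper [set a]) b = sset_add _ _ hiv.
    by apply: sset_add_eq; rewrite ?scompl_upper ?scompl1 // !lowerU lower_upper1.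
  have e2 : imp_ss (upper [set a]) (upper [set b]) = sset_add _ _ hiv.
    by apply: sset_add_eq; rewrite ?scompl_upper ?scompl1 // !lowerU !lower_upper1.
  have e3 : imp_se (upper [set ecompl a; ecompl b]) (ecompl a) = sset_add _ _ hiv.
    (* Here the summands come in the opposite order: U(a', b')' = L(a, b) is the first, and L(U(a',
       b'), a') = L(a') the second. *)
    rewrite (sset_addC hiv hvi'); apply: sset_add_eq.
      by rewrite scompl_upper scompl2 !ecomplK.
    by rewrite setUC lower_U_upper //; left.
  by exists hiv; rewrite e1 e2 e3.
split.
  have h0 : sle [set ezero] [set ecompl (ecompl a)].
    by move=> _ _ -> ->; exact: ele0x.
  rewrite -(eset_add0 h0); apply: eset_add_eq; apply: lower_with0.
  by right=> y _; exact: ele0x.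
split; first by exists hvi.
rewrite evi; apply/seteqP; split=> [x Ux|_ -> y _]; last exact: elex1.
(* As [a] lies in L(a), the set a' + L(a) contains a' + a = 1, so its upper bound [x] is above 1. *)
apply: ele1x; apply: Ux; exists a; first exact/lower1P/ele_refl.
by rewrite eaddC; exact: eadd_compl.
Qed.
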